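(* For complex $a,c$ with $|a|<1$ and $|c|<1$, \begin{align*} \sum_{n=0}^\infty \frac{(q/c; q)_n c^n}{\bigl(q^2; q^2\bigr)_n (1+aq^n)} q^{n(n+1)/2} =\frac{(qa, qc, -ac; q)_\infty}{(q, ac, -a; q)_{\infty}}\sum_{n=0}^\infty \sum_{j=-n}^n (-1)^j \bigl(1-q^{2n+1}\bigr) q^{n^2-j^2}\frac{(q/a, q/c; q)_n (ac)^n}{(qa, qc; q)_n}. \end{align*}
   Context: Throughout, $q$ is a complex number with $0<|q|<1$. For $x\in\mathbb{C}$ and base $p\in\{q,q^2\}$, $(x;p)_\infty=\prod_{k=0}^\infty(1-xp^k)$ and, for an integer $n\ge 0$, $(x;p)_n=\prod_{k=0}^{n-1}(1-xp^k)$; also $(x_1,\dots,x_m;p)_n=(x_1;p)_n\cdots(x_m;p)_n$ for $n$ an integer or $\infty$. *)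

(* Defs.v *)
From Stdlib Require Import Reals.
From Coquelicot Require Import Coquelicot.

Local Open Scope C_scope.

(* The limit of a complex sequence (meaningful when it converges). *)
Definition climit (u : nat -> C) : C :=
  @iota (CompleteNormedModule.CompleteSpace _ C_CompleteNormedModule)
        (fun l : C => filterlim u eventually (locally l)).

Definition cpow (z : C) (n : nat) : C := pow_n (K := C_Ring) z n.

Fixpoint qpoch (x p : C) (n : nat) : C :=
  match n with
  | O => 1
  | S m => qpoch x p m * (1 - x * cpow p m)
  end.

Definition qpoch_inf (x p : C) : C := climit (qpoch x p).

(* Main.v *)
(** Both sides are expressed through the series
    [X = sum_n (q/a, q/c; q)_n (-ac)^n / (q^2; q^2)_n].

    The right-hand side is Bailey's lemma relative to [q] with parameters
    [q/a], [q/c], applied to the Bailey pair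
    [alpha_r = (1 - q^(2r+1)) q^(r^2) sum_{|j| <= r} (-1)^j q^(-j^2)],
    [beta_n = (-1)^n / (q^2; q^2)_n] (up to a common factor [1 - q]).  It gives
    [X = (qa, qc)_oo / (q, ac)_oo * S], where [S] is the double sum.

    The left-hand side, multiplied by [1 + a], is the series
    [2phi2(q/c, -a; -q, -aq; q, -qc)], because [1/(1 + a q^n)] is
    [(-a)_n / ((1 + a) (-aq)_n)].  Jackson's transformation of [2phi1] into
    [2phi2] turns it into [(-ac)_oo / (-a)_oo * X].

    Both transformations are proved in a finite form, where the interchange of
    summations is harmless: the [n]-th term carries the extra weight
    [(z)_{N-n} / (q)_{N-n}], which makes the inner sums evaluable by the
    q-Pfaff-Saalschuetz and q-Vandermonde formulas.  Tannery's theorem then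
    allows [N] to tend to infinity, every summand being geometrically bounded. *)

Require Import Defs.
From Stdlib Require Import Reals ZArith Lia Lra.
From Coquelicot Require Import Coquelicot.

Local Open Scope C_scope.

(** * Finite sums and q-shifted factorials *)

Definition csum (f : nat -> C) (n : nat) : C := sum_n f n.

Lemma csum_0 (f : nat -> C) : csum f 0 = f O.
Proof. exact (sum_O f). Qed.

Lemma csum_S (f : nat -> C) (n : nat) : csum f (S n) = csum f n + f (S n).
Proof. exact (sum_Sn f n). Qed.

Lemma csum_ext (f g : nat -> C) (n : nat) :
  (forall k, (k <= n)%nat -> f k = g k) -> csum f n = csum g n.
Proof. exact (sum_n_ext_loc f g n). Qed.

Lemma csum_plus (f g : nat -> C) (n : nat) :
  csum (fun k => f k + g k) n = csum f n + csum g n.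
Proof. exact (sum_n_plus f g n). Qed.

Lemma csum_scal (x : C) (f : nat -> C) (n : nat) :
  csum (fun k => x * f k) n = x * csum f n.
Proof. exact (sum_n_mult_l (K := C_Ring) x f n). Qed.

Lemma csum_shift (f : nat -> C) (n : nat) :
  csum f (S n) = f O + csum (fun k => f (S k)) n.
Proof.
  induction n as [|n IH].
  - now rewrite csum_S, !csum_0.
  - rewrite csum_S, IH, csum_S. ring.
Qed.

(** Interchange of summations over the triangle [k <= n <= N], with the inner index counted from the
    diagonal as [n = k + m]. Both finite transformations below rest on it. *)
Lemma csum_triangle (F : nat -> nat -> C) (N : nat) :
  csum (fun n => csum (F n) n) N
  = csum (fun k => csum (fun m => F (k + m)%nat k) (N - k)) N.
Proof.
  induction N as [|N IH].
  - change (0 - 0)%nat with O. now rewrite !csum_0.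
  - rewrite csum_S, IH, (csum_S (F (S N))), (csum_S _ N); cbv beta.
    rewrite Nat.sub_diag, csum_0, Nat.add_0_r, Cplus_assoc, <- csum_plus.
    f_equal. apply csum_ext. intros k Hk.
    rewrite (Nat.sub_succ_l k N) by lia. rewrite csum_S.
    now replace (k + S (N - k))%nat with (S N) by lia.
Qed.

Lemma Cmult_cancel_l (x y z : C) : x <> 0 -> x * y = x * z -> y = z.
Proof.
  intros Hx H. replace y with (/ x * (x * y)) by (field; auto).
  rewrite H. field. auto.
Qed.

(* Coquelicot's [/ 0] is [0], so no hypothesis is required. *)
Lemma Cinv_mult (x y : C) : / (x * y) = / x * / y.
Proof.
  assert (Z : Cinv 0 = 0).
  { apply injective_projections; simpl; unfold Rdiv; ring. }
  destruct (Ceq_dec x 0) as [->|Hx].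
  - rewrite Z, !Cmult_0_l. exact Z.
  - destruct (Ceq_dec y 0) as [->|Hy].
    + rewrite Z, !Cmult_0_r. exact Z.
    + field. auto.
Qed.

Lemma cpow_S (z : C) (n : nat) : cpow z (S n) = z * cpow z n.
Proof. reflexivity. Qed.

Lemma cpow_add (z : C) (n m : nat) : cpow z (n + m) = cpow z n * cpow z m.
Proof. exact (pow_n_plus (K := C_Ring) z n m). Qed.

Lemma cpow_mul (x y : C) (n : nat) : cpow (x * y) n = cpow x n * cpow y n.
Proof. induction n as [|n IH]; [cbn; ring | rewrite !cpow_S, IH; ring]. Qed.

Lemma qpoch_S (x q : C) (n : nat) :
  qpoch x q (S n) = qpoch x q n * (1 - x * cpow q n).
Proof. reflexivity. Qed.

Lemma qpoch_add (x q : C) (n m : nat) :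
  qpoch x q (n + m) = qpoch x q n * qpoch (x * cpow q n) q m.
Proof.
  induction m as [|m IH].
  - rewrite Nat.add_0_r. cbn. ring.
  - rewrite Nat.add_succ_r, !qpoch_S, IH, cpow_add. ring.
Qed.

Lemma qpoch_shift (x q : C) (n : nat) :
  qpoch x q (S n) = (1 - x) * qpoch (x * q) q n.
Proof.
  change (S n) with (1 + n)%nat. rewrite qpoch_add, qpoch_S.
  replace (cpow q 1) with q by (cbn; ring). cbn. ring.
Qed.

Lemma qpoch_neq0 (x q : C) (n : nat) :
  (forall k, 1 - x * cpow q k <> 0) -> qpoch x q n <> 0.
Proof.
  intros H. induction n as [|n IH].
  - exact C1_nz.
  - rewrite qpoch_S. now apply Cmult_neq_0.
Qed.

(** * Summation and transformation formulas *)

(** With [j = M - m] this is, up to the factor (z)_M / (q)_M, the summand of the balanced series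
    3phi2(A, B, q^(-M); ABz, q^(1-M)/z; q, q). Reversing the factors that involve q^(-M) leaves only
    nonnegative powers of [q] and turns the sum into a convolution. *)
Definition saalschutz_term (q A B z : C) (m j : nat) : C :=
  qpoch A q m * qpoch B q m * qpoch z q j * cpow z m
  / (qpoch q q m * qpoch q q j * qpoch (A * B * z) q m).

(* Gosper's algorithm applied to the recurrence in [M] of the
   q-Pfaff-Saalschuetz sum, combined with the q-Pascal rule, produces this
   closed form of the partial sums; the remaining term of the longer sum
   cancels it for [k = M]. *)
Lemma saalschutz_partial (q A B z : C) (M k j : nat) :
  (forall n, 1 - q * cpow q n <> 0) ->
  (forall n, 1 - A * B * z * cpow q n <> 0) ->
  M = (k + j)%nat ->
  csum (fun m =>
          (1 - q * cpow q M) * (1 - A * B * z * cpow q M)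
            * saalschutz_term q A B z m (S M - m)
          - (1 - z * A * cpow q M) * (1 - z * B * cpow q M)
            * saalschutz_term q A B z m (M - m)) k
  = - (cpow q j * z * (1 - A * cpow q k) * (1 - B * cpow q k)
       * saalschutz_term q A B z k j).
Proof.
  intros Hq HC. revert j. induction k as [|k IH]; intros j HM.
  - rewrite csum_0, !Nat.sub_0_r. simpl in HM. subst j.
    unfold saalschutz_term. rewrite !qpoch_S. cbn.
    pose proof (qpoch_neq0 q q M Hq). pose proof (Hq M).
    fold (cpow q M).
    field. repeat split; auto.
  - rewrite csum_S, (IH (S j)) by lia.
    replace (S M - S k)%nat with (S j) by lia.
    replace (M - S k)%nat with j by lia.
    unfold saalschutz_term.
    rewrite HM. replace (S k + j)%nat with (S (k + j)) by lia.
    rewrite !qpoch_S, !cpow_S, !cpow_add.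
    pose proof (qpoch_neq0 q q k Hq). pose proof (Hq k).
    pose proof (qpoch_neq0 q q j Hq). pose proof (Hq j).
    pose proof (qpoch_neq0 _ q k HC). pose proof (HC k).
    field. repeat split; auto.
Qed.

Lemma saalschutz (q A B z : C) (M : nat) :
  (forall n, 1 - q * cpow q n <> 0) ->
  (forall n, 1 - A * B * z * cpow q n <> 0) ->
  csum (fun m => saalschutz_term q A B z m (M - m)) M
  = qpoch (z * A) q M * qpoch (z * B) q M / (qpoch q q M * qpoch (A * B * z) q M).
Proof.
  intros Hq HC. induction M as [|M IH].
  - rewrite csum_0. unfold saalschutz_term. cbn. field.
  - pose proof (saalschutz_partial q A B z M M 0 Hq HC (eq_sym (Nat.add_0_r M))) as H.
    pose proof (qpoch_neq0 q q M Hq). pose proof (Hq M).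
    pose proof (qpoch_neq0 _ q M HC). pose proof (HC M).
    rewrite (csum_ext _
      (fun m => (1 - q * cpow q M) * (1 - A * B * z * cpow q M)
                  * saalschutz_term q A B z m (S M - m)
                + - ((1 - z * A * cpow q M) * (1 - z * B * cpow q M))
                  * saalschutz_term q A B z m (M - m))) in H
      by (intros; ring).
    rewrite csum_plus, !csum_scal, IH in H.
    rewrite csum_S, Nat.sub_diag.
    apply (Cmult_cancel_l ((1 - q * cpow q M) * (1 - A * B * z * cpow q M)));
      [now apply Cmult_neq_0|].
    rewrite Cmult_plus_distr_l.
    match type of H with ?x + ?y = ?z => assert (H' : x = z - y) by (rewrite <- H; ring) end.
    rewrite H'. unfold saalschutz_term. rewrite !qpoch_S, !cpow_S.
    cbn [qpoch]. change (cpow q 0) with (1 : C). field. repeat split; auto.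
Qed.

(** The case [B = 0] of [saalschutz], since (0; q)_n = 1. It compares the coefficients of t^M in
    (Azt)_oo / (zt)_oo times (zt)_oo / (t)_oo. *)
Corollary q_vandermonde (q A z : C) (M : nat) :
  (forall n, 1 - q * cpow q n <> 0) ->
  csum (fun m => qpoch A q m * cpow z m * qpoch z q (M - m)
                 / (qpoch q q m * qpoch q q (M - m))) M
  = qpoch (A * z) q M / qpoch q q M.
Proof.
  intros Hq.
  assert (Z : forall n, qpoch 0 q n = 1).
  { induction n as [|n IH]; [reflexivity | rewrite qpoch_S, IH; ring]. }
  assert (H0 : forall n, 1 - A * 0 * z * cpow q n <> 0).
  { intros n. replace (1 - A * 0 * z * cpow q n) with (1 : C) by ring. exact C1_nz. }
  pose proof (saalschutz q A 0 z M Hq H0) as H.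
  replace (A * 0 * z) with (0 : C) in H by ring.
  replace (z * 0) with (0 : C) in H by ring. rewrite Z in H.
  replace (A * z) with (z * A) by ring.
  transitivity (qpoch (z * A) q M * 1 / (qpoch q q M * 1)).
  2: { pose proof (qpoch_neq0 q q M Hq). field. auto. }
  rewrite <- H. apply csum_ext. intros m _. unfold saalschutz_term.
  replace (A * 0 * z) with (0 : C) by ring. rewrite !Z.
  pose proof (qpoch_neq0 q q m Hq). pose proof (qpoch_neq0 q q (M - m) Hq).
  field. auto.
Qed.

Lemma triangular_S (n : nat) : (S n * (S n + 1) / 2 = n * (n + 1) / 2 + S n)%nat.
Proof.
  replace (S n * (S n + 1))%nat with (n * (n + 1) + S n * 2)%nat by lia.
  now rewrite Nat.div_add.
Qed.

Definition expansion_term (q b D : C) (k j : nat) : C :=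
  cpow (-1) k * cpow q (k * (k + 1) / 2) * cpow b k * qpoch D q k
  * qpoch (b * D * q * cpow q k) q j / (qpoch q q k * qpoch q q j).

(** If S_n(b) is the full sum of [expansion_term], then (1 - q^(n+1)) S_(n+1)(b) = (1 - bq) S_n(bq).
    The difference of the two sides telescopes, and this is the closed form of its partial sums. *)
Lemma expansion_partial (q b D : C) (n k j : nat) :
  (forall n, 1 - q * cpow q n <> 0) ->
  n = (k + j)%nat ->
  csum (fun m => (1 - q * cpow q n) * expansion_term q b D m (S n - m)
                 - (1 - b * q) * expansion_term q (b * q) D m (n - m)) k
  = - ((1 - q * cpow q k) * expansion_term q b D (S k) j).
Proof.
  intros Hq. revert j. induction k as [|k IH]; intros j Hn.
  - rewrite csum_0, !Nat.sub_0_r. simpl in Hn. subst j.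
    unfold expansion_term. change (0 * (0 + 1) / 2)%nat with O.
    change (1 * (1 + 1) / 2)%nat with 1%nat.
    rewrite (qpoch_shift (b * D * q * cpow q 0)).
    rewrite !qpoch_S, !cpow_S. change (cpow q 0) with (1 : C).
    change (cpow b 0) with (1 : C). change (cpow (b * q) 0) with (1 : C).
    change (cpow (-1) 0) with (1 : C). cbn [qpoch].
    replace (b * D * q * 1 * q) with (b * D * q * q) by ring.
    replace (b * q * D * q * 1) with (b * D * q * q) by ring.
    replace (b * D * q * (q * 1)) with (b * D * q * q) by ring.
    pose proof (qpoch_neq0 q q n Hq). pose proof (Hq n). pose proof (Hq O) as Hq0.
    change (cpow q 0) with (1 : C) in Hq0.
    rewrite Cmult_1_r in Hq0. field. repeat split; auto.
  - rewrite csum_S, (IH (S j)) by lia.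
    replace (S n - S k)%nat with (S j) by lia.
    replace (n - S k)%nat with j by lia.
    unfold expansion_term.
    rewrite Hn. replace (S k + j)%nat with (S (k + j)) by lia.
    rewrite !triangular_S.
    rewrite (qpoch_shift (b * D * q * cpow q (S k))).
    rewrite !cpow_add, !cpow_S, !cpow_mul, !qpoch_S, !cpow_S, !cpow_add.
    replace (b * q * D * q * (q * cpow q k)) with (b * D * q * (q * cpow q k) * q) by ring.
    replace (b * D * q * (q * (q * cpow q k))) with (b * D * q * (q * cpow q k) * q) by ring.
    pose proof (qpoch_neq0 q q k Hq). pose proof (Hq k). pose proof (Hq (S k)) as H1.
    rewrite cpow_S in H1.
    pose proof (qpoch_neq0 q q j Hq). pose proof (Hq j).
    field. repeat split; auto.
Qed.

(** This is the q-Chu-Vandermonde sum 2phi1(q^(-n), D; bDq; q, b q^(n+1)) = (bq)_n / (bDq)_n with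
    denominators cleared. As the recurrence replaces [b] by [b * q], the induction on [n] keeps [b]
    general. *)
Lemma qpoch_expansion (q b D : C) (n : nat) :
  (forall n, 1 - q * cpow q n <> 0) ->
  csum (fun k => expansion_term q b D k (n - k)) n
  = qpoch (b * q) q n / qpoch q q n.
Proof.
  intros Hq. revert b. induction n as [|n IH]; intros b.
  - rewrite csum_0. unfold expansion_term. cbn. field.
  - pose proof (expansion_partial q b D n n 0 Hq (eq_sym (Nat.add_0_r n))) as H.
    pose proof (qpoch_neq0 q q n Hq). pose proof (Hq n).
    rewrite (csum_ext _
      (fun m => (1 - q * cpow q n) * expansion_term q b D m (S n - m)
                + - (1 - b * q) * expansion_term q (b * q) D m (n - m))) in H
      by (intros; ring).
    rewrite csum_plus, !csum_scal, IH in H.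
    rewrite csum_S, Nat.sub_diag.
    apply (Cmult_cancel_l (1 - q * cpow q n)); [assumption|].
    rewrite Cmult_plus_distr_l.
    match type of H with ?x + ?y = ?z => assert (H' : x = z - y) by (rewrite <- H; ring) end.
    rewrite H', (qpoch_shift (b * q)), qpoch_S.
    field. auto.
Qed.

(* Jackson's transformation with [B = b q] and [C = b D q]; the usual form is
   recovered by letting [N] tend to infinity. *)
Lemma finite_jackson (q A b D z : C) (N : nat) :
  (forall n, 1 - q * cpow q n <> 0) ->
  (forall n, 1 - b * D * q * cpow q n <> 0) ->
  csum (fun n => qpoch A q n * qpoch (b * q) q n * cpow z n
                 / (qpoch q q n * qpoch (b * D * q) q n)
                 * (qpoch z q (N - n) / qpoch q q (N - n))) N
  = csum (fun k => qpoch A q k * cpow z k * cpow (-1) k * cpow q (k * (k + 1) / 2)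
                   * cpow b k * qpoch D q k / (qpoch q q k * qpoch (b * D * q) q k)
                   * (qpoch (A * z * cpow q k) q (N - k) / qpoch q q (N - k))) N.
Proof.
  intros Hq HC.
  (* The quotient (bq)_n / (q)_n is expanded by [qpoch_expansion], so that only a sum over [n] of
     q-Vandermonde type remains after the interchange. *)
  rewrite (csum_ext _ (fun n => csum (fun k =>
     qpoch A q n * cpow z n / qpoch (b * D * q) q n
     * (qpoch z q (N - n) / qpoch q q (N - n))
     * expansion_term q b D k (n - k)) n)).
  2: { intros n Hn. rewrite csum_scal, qpoch_expansion by assumption.
       pose proof (qpoch_neq0 q q n Hq). pose proof (qpoch_neq0 q q (N - n) Hq).
       pose proof (qpoch_neq0 _ q n HC). field. auto. }
  rewrite (csum_triangle (fun n k => qpoch A q n * cpow z n / qpoch (b * D * q) q n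
     * (qpoch z q (N - n) / qpoch q q (N - n))
     * expansion_term q b D k (n - k))).
  apply csum_ext. intros k Hk.
  (* The inner sum is q-Vandermonde with [A] replaced by A q^k. *)
  replace (A * z * cpow q k) with (A * cpow q k * z) by ring.
  rewrite <- q_vandermonde by assumption.
  rewrite <- csum_scal. apply csum_ext. intros m Hm.
  unfold expansion_term.
  replace (k + m - k)%nat with m by lia.
  replace (N - (k + m))%nat with (N - k - m)%nat by lia.
  rewrite !qpoch_add with (n := k), cpow_add.
  pose proof (qpoch_neq0 q q m Hq). pose proof (qpoch_neq0 q q k Hq).
  pose proof (qpoch_neq0 q q (N - k - m) Hq).
  pose proof (qpoch_neq0 _ q (k + m) HC) as H3. rewrite qpoch_add in H3.
  assert (qpoch (b * D * q) q k <> 0) by now apply qpoch_neq0.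
  assert (qpoch (b * D * q * cpow q k) q m <> 0).
  { intros E. apply H3. rewrite E. ring. }
  field. repeat split; auto.
Qed.

(** Bailey's lemma with parameters [A], [B], for a pair relative to ABz/q. After the interchange,
    the coefficient of [alpha r] is a q-Pfaff-Saalschuetz sum with A q^r and B q^r in place of [A]
    and [B]. *)
Lemma finite_bailey (q A B z : C) (alpha : nat -> C) (N : nat) :
  (forall n, 1 - q * cpow q n <> 0) ->
  (forall n, 1 - A * B * z * cpow q n <> 0) ->
  csum (fun n => qpoch A q n * qpoch B q n * cpow z n
                 * csum (fun r => alpha r / (qpoch q q (n - r) * qpoch (A * B * z) q (n + r))) n
                 * (qpoch z q (N - n) / qpoch q q (N - n))) N
  = csum (fun r => alpha r * qpoch A q r * qpoch B q r * cpow z r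
                   * (qpoch (z * A * cpow q r) q (N - r) * qpoch (z * B * cpow q r) q (N - r)
                      / (qpoch q q (N - r) * qpoch (A * B * z) q (N + r)))) N.
Proof.
  intros Hq HC.
  set (F := fun n r => qpoch A q n * qpoch B q n * cpow z n
     * (qpoch z q (N - n) / qpoch q q (N - n))
     * (alpha r / (qpoch q q (n - r) * qpoch (A * B * z) q (n + r)))).
  rewrite (csum_ext _ (fun n => csum (F n) n)).
  2: { intros n Hn. unfold F. rewrite csum_scal. ring. }
  rewrite csum_triangle. apply csum_ext. intros r Hr. unfold F.
  assert (HC' : forall n, 1 - A * cpow q r * (B * cpow q r) * z * cpow q n <> 0).
  { intros n. replace (A * cpow q r * (B * cpow q r) * z * cpow q n)
      with (A * B * z * cpow q (r + r + n)); [apply HC | rewrite !cpow_add; ring]. }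
  pose proof (saalschutz q (A * cpow q r) (B * cpow q r) z (N - r) Hq HC') as H.
  (* The first 2r factors do not depend on the inner index; the others form the lower parameter ABz
     q^(2r) of the shifted Saalschuetz sum. *)
  assert (E : forall k, qpoch (A * B * z) q (r + k + r)
     = qpoch (A * B * z) q (r + r) * qpoch (A * cpow q r * (B * cpow q r) * z) q k).
  { intros k. replace (r + k + r)%nat with (r + r + k)%nat by lia.
    rewrite qpoch_add, cpow_add. do 2 f_equal. ring. }
  assert (qpoch (A * B * z) q (r + r) <> 0) by now apply qpoch_neq0.
  replace (N + r)%nat with (r + (N - r) + r)%nat by lia. rewrite E.
  transitivity (alpha r * qpoch A q r * qpoch B q r * cpow z r / qpoch (A * B * z) q (r + r)
    * (qpoch (z * (A * cpow q r)) q (N - r) * qpoch (z * (B * cpow q r)) q (N - r) /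
        (qpoch q q (N - r) * qpoch (A * cpow q r * (B * cpow q r) * z) q (N - r)))).
  2: { pose proof (qpoch_neq0 q q (N - r) Hq). pose proof (qpoch_neq0 _ q (N - r) HC').
       rewrite <- (Cmult_assoc z A), <- (Cmult_assoc z B). field. auto. }
  rewrite <- H, <- csum_scal. apply csum_ext. intros m Hm. unfold saalschutz_term.
  replace (r + m - r)%nat with m by lia.
  replace (N - (r + m))%nat with (N - r - m)%nat by lia.
  rewrite E, (qpoch_add A), (qpoch_add B), cpow_add.
  pose proof (qpoch_neq0 q q m Hq). pose proof (qpoch_neq0 q q (N - r - m) Hq).
  pose proof (qpoch_neq0 _ q m HC').
  field. repeat split; auto.
Qed.

(** * The Bailey pair *)

Lemma cpow_m1_sqr (n : nat) : cpow (-1) n * cpow (-1) n = 1.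
Proof.
  induction n as [|n IH]; [cbn; ring|].
  rewrite cpow_S. transitivity (cpow (-1) n * cpow (-1) n); [ring | exact IH].
Qed.

(* The generating function [1/((x; q)_oo (-x; q)_oo) = 1/(x^2; q^2)_oo] shows
   that the alternating sums vanish for odd [m] and satisfy a two-step
   recurrence; here the latter is obtained by telescoping. *)
Lemma alternating_partial (q : C) (m k j : nat) :
  (forall n, 1 - q * cpow q n <> 0) ->
  m = (k + j)%nat ->
  csum (fun i =>
          (1 - q * (q * cpow q m)) * (cpow (-1) i / (qpoch q q i * qpoch q q (S (S m) - i)))
          - cpow (-1) i / (qpoch q q i * qpoch q q (m - i))) k
  = q * cpow q j * (cpow (-1) k / (qpoch q q k * qpoch q q (S j))).
Proof.
  intros Hq. revert j. induction k as [|k IH]; intros j Hm.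
  - rewrite csum_0, !Nat.sub_0_r. simpl in Hm. subst j.
    pose proof (qpoch_neq0 q q m Hq). pose proof (Hq m). pose proof (Hq (S m)) as Hq1.
    rewrite !qpoch_S, cpow_S in *. change (cpow (-1) 0) with (1 : C). cbn [qpoch].
    field. repeat split; auto.
  - rewrite csum_S, (IH (S j)) by lia.
    replace (S (S m) - S k)%nat with (S (S j)) by lia.
    replace (m - S k)%nat with j by lia.
    rewrite Hm. replace (S k + j)%nat with (S (k + j)) by lia.
    pose proof (qpoch_neq0 q q k Hq). pose proof (Hq k).
    pose proof (qpoch_neq0 q q j Hq). pose proof (Hq j). pose proof (Hq (S j)) as Hq1.
    rewrite !qpoch_S, !cpow_S, cpow_add in *.
    field. repeat split; auto.
Qed.

Lemma alternating_rec (q : C) (m : nat) :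
  (forall n, 1 - q * cpow q n <> 0) ->
  (1 - q * (q * cpow q m))
    * csum (fun i => cpow (-1) i / (qpoch q q i * qpoch q q (S (S m) - i))) (S (S m))
  = csum (fun i => cpow (-1) i / (qpoch q q i * qpoch q q (m - i))) m.
Proof.
  intros Hq.
  pose proof (alternating_partial q m m 0 Hq (eq_sym (Nat.add_0_r m))) as H.
  rewrite (csum_ext _
    (fun i => (1 - q * (q * cpow q m))
                * (cpow (-1) i / (qpoch q q i * qpoch q q (S (S m) - i)))
              + - (1) * (cpow (-1) i / (qpoch q q i * qpoch q q (m - i))))) in H
    by (intros; ring).
  rewrite csum_plus, !csum_scal in H.
  (* The longer sum has two more terms, [i = m + 1] and [i = m + 2]; together they cancel the closed
     form from [alternating_partial]. *)
  rewrite !csum_S, !Cmult_plus_distr_l.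
  match type of H with ?x + ?y = ?z => assert (H' : x = z - y) by (rewrite <- H; ring) end.
  rewrite H'.
  rewrite Nat.sub_diag. replace (S (S m) - S m)%nat with 1%nat by lia.
  pose proof (qpoch_neq0 q q m Hq). pose proof (Hq m). pose proof (Hq (S m)) as Hq1.
  pose proof (Hq O) as Hq2. change (cpow q 0) with (1 : C) in *. rewrite Cmult_1_r in Hq2.
  rewrite !qpoch_S, !cpow_S in *. change (cpow q 0) with (1 : C). cbn [qpoch].
  field. repeat split; auto.
Qed.

(** Only even lengths occur later, because a sum over -n <= j <= n has 2n + 1 terms. The recurrence
    factor splits as 1 - q^(2n+2) = (1 - q^(n+1))(1 + q^(n+1)). *)
Lemma alternating_even (q : C) (n : nat) :
  (forall n, 1 - q * cpow q n <> 0) -> (forall n, 1 - - q * cpow q n <> 0) ->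
  csum (fun i => cpow (-1) i / (qpoch q q i * qpoch q q (2 * n - i))) (2 * n)
  = / (qpoch q q n * qpoch (- q) q n).
Proof.
  intros Hq Hmq. induction n as [|n IH].
  - change (2 * 0)%nat with O. rewrite csum_0. cbn. field.
  - replace (2 * S n)%nat with (S (S (2 * n))) by lia.
    pose proof (alternating_rec q (2 * n) Hq) as H. rewrite IH in H.
    pose proof (Hq n) as Hq1. pose proof (Hmq n) as Hq2.
    assert (E : 1 - q * (q * cpow q (2 * n))
                = (1 - q * cpow q n) * (1 - - q * cpow q n)).
    { replace (2 * n)%nat with (n + n)%nat by lia. rewrite cpow_add. ring. }
    rewrite E in H.
    apply (Cmult_cancel_l ((1 - q * cpow q n) * (1 - - q * cpow q n)));
      [now apply Cmult_neq_0|].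
    rewrite H, !qpoch_S.
    pose proof (qpoch_neq0 q q n Hq). pose proof (qpoch_neq0 (- q) q n Hmq).
    field. repeat split; auto.
Qed.

(* The sum of [f |j|] over [-n <= j <= n], indexed by [k = j + n]. *)
Definition symsum (f : nat -> C) (n : nat) : C :=
  csum (fun k => f (Z.abs_nat (Z.of_nat k - Z.of_nat n))) (2 * n).

Lemma symsum_ext (f g : nat -> C) (n : nat) :
  (forall k, (k <= n)%nat -> f k = g k) -> symsum f n = symsum g n.
Proof. intros H. apply csum_ext. intros k Hk. apply H. lia. Qed.

Lemma symsum_scal (x : C) (f : nat -> C) (n : nat) :
  symsum (fun k => x * f k) n = x * symsum f n.
Proof. exact (csum_scal x _ (2 * n)). Qed.

Lemma symsum_0 (f : nat -> C) : symsum f 0 = f O.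
Proof. exact (csum_0 _). Qed.

Lemma symsum_S (f : nat -> C) (n : nat) :
  symsum f (S n) = symsum f n + 2 * f (S n).
Proof.
  unfold symsum. replace (2 * S n)%nat with (S (S (2 * n))) by lia.
  rewrite csum_S, csum_shift.
  replace (Z.abs_nat (Z.of_nat 0 - Z.of_nat (S n))) with (S n) by lia.
  replace (Z.abs_nat (Z.of_nat (S (S (2 * n))) - Z.of_nat (S n))) with (S n) by lia.
  rewrite (csum_ext _ (fun k => f (Z.abs_nat (Z.of_nat k - Z.of_nat n)))).
  2: { intros k _. f_equal. lia. }
  ring.
Qed.

(** The inner Hecke-type sum over |j| <= r, with q^(r^2) absorbed: the exponent r^2 - j^2 is then
    nonnegative, so the natural subtraction is exact. *)
Definition indefinite_theta (q : C) (r : nat) : C :=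
  symsum (fun j => cpow (-1) j * cpow q (r * r - j * j)) r.

(** Passing from r to r + 1 multiplies each old term by q^(2r+1), and the two new terms j = -(r+1),
    r+1 have exponent 0. The recurrence serves both the summation by parts and the uniform bound. *)
Lemma indefinite_theta_S (q : C) (r : nat) :
  indefinite_theta q (S r)
  = cpow q (2 * r + 1) * indefinite_theta q r + 2 * cpow (-1) (S r).
Proof.
  unfold indefinite_theta. rewrite symsum_S, Nat.sub_diag, <- symsum_scal.
  rewrite (symsum_ext _
    (fun j => cpow q (2 * r + 1) * (cpow (-1) j * cpow q (r * r - j * j)))).
  - change (cpow q 0) with (1 : C). ring.
  - intros j Hj. assert (j * j <= r * r)%nat by nia.
    replace (S r * S r - j * j)%nat with (2 * r + 1 + (r * r - j * j))%nat by lia.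
    rewrite cpow_add. ring.
Qed.

(* Summation by parts: [(1 - q^(2r+1)) q^(r^2) / ((q)_{n-r} (q)_{n+r+1})] is the
   difference [U_r - U_{r+1}] of [U_r = q^(r^2) / ((q)_{n-r} (q)_{n+r})], and
   [U_j] cancels the factor [q^(-j^2)]. *)
Lemma bailey_pair_partial (q : C) (n k j : nat) :
  (forall n, 1 - q * cpow q n <> 0) ->
  n = (k + j)%nat ->
  csum (fun r => (1 - cpow q (2 * r + 1)) * indefinite_theta q r
                 / (qpoch q q (n - r) * qpoch q q (S (n + r)))) k
  = symsum (fun i => cpow (-1) i / (qpoch q q (n - i) * qpoch q q (n + i))) k
    - cpow q (2 * k + 1) * (1 - cpow q j) * indefinite_theta q k
      / (qpoch q q j * qpoch q q (S (n + k))).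
Proof.
  intros Hq. revert j. induction k as [|k IH]; intros j Hn.
  - rewrite csum_0, symsum_0, !Nat.sub_0_r, !Nat.add_0_r. simpl in Hn. subst j.
    unfold indefinite_theta. rewrite symsum_0.
    pose proof (qpoch_neq0 q q n Hq). pose proof (Hq n).
    rewrite !qpoch_S. cbn [Nat.mul Nat.add Nat.sub].
    rewrite !cpow_S. change (cpow q 0) with (1 : C). change (cpow (-1) 0) with (1 : C).
    field. repeat split; auto.
  - rewrite csum_S, symsum_S, (IH (S j)) by lia.
    rewrite indefinite_theta_S.
    replace (n - S k)%nat with j by lia.
    rewrite !(Nat.add_succ_r n).
    replace (2 * S k + 1)%nat with (S (S (2 * k + 1))) by lia.
    pose proof (qpoch_neq0 q q j Hq). pose proof (Hq j).
    pose proof (qpoch_neq0 q q (n + k) Hq). pose proof (Hq (n + k)%nat) as Hq1.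
    pose proof (Hq (S (n + k))) as Hq2.
    rewrite !qpoch_S, !cpow_S in *.
    (* All powers are reduced to q^(2k+1) and q^j, after which the identity is rational in
       independent quantities. *)
    assert (E : cpow q (n + k) = cpow q (2 * k + 1) * cpow q j).
    { rewrite <- cpow_add. f_equal. lia. }
    rewrite E in *.
    field. repeat split; auto.
Qed.

Lemma bailey_pair (q : C) (n : nat) :
  (forall n, 1 - q * cpow q n <> 0) -> (forall n, 1 - - q * cpow q n <> 0) ->
  csum (fun r => (1 - cpow q (2 * r + 1)) * indefinite_theta q r
                 / (qpoch q q (n - r) * qpoch q q (S (n + r)))) n
  = cpow (-1) n / (qpoch q q n * qpoch (- q) q n).
Proof.
  intros Hq Hmq.
  (* At [k = n] the remainder vanishes through its factor 1 - q^0. The index shift k = j + n then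
     turns the symmetric sum into (-1)^n times the alternating sum of length 2n. *)
  rewrite (bailey_pair_partial q n n 0 Hq (eq_sym (Nat.add_0_r n))).
  unfold Cdiv at 3. rewrite <- alternating_even by assumption.
  rewrite <- csum_scal. unfold symsum.
  rewrite (csum_ext _ (fun k => cpow (-1) n
             * (cpow (-1) k / (qpoch q q k * qpoch q q (2 * n - k))))).
  - change (cpow q 0) with (1 : C). unfold Cdiv. ring.
  - intros k Hk. destruct (Nat.le_ge_cases k n) as [H|H].
    + replace (Z.abs_nat (Z.of_nat k - Z.of_nat n)) with (n - k)%nat by lia.
      replace (n - (n - k))%nat with k by lia.
      replace (n + (n - k))%nat with (2 * n - k)%nat by lia.
      replace (cpow (-1) n) with (cpow (-1) (n - k) * cpow (-1) k)
        by (rewrite <- cpow_add; f_equal; lia).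
      unfold Cdiv.
      transitivity (cpow (-1) (n - k) * (cpow (-1) k * cpow (-1) k)
                    * / (qpoch q q k * qpoch q q (2 * n - k))); [|ring].
      rewrite cpow_m1_sqr. ring.
    + replace (Z.abs_nat (Z.of_nat k - Z.of_nat n)) with (k - n)%nat by lia.
      replace (n - (k - n))%nat with (2 * n - k)%nat by lia.
      replace (n + (k - n))%nat with k by lia.
      replace (cpow (-1) k) with (cpow (-1) (k - n) * cpow (-1) n)
        by (rewrite <- cpow_add; f_equal; lia).
      unfold Cdiv. rewrite (Cmult_comm (qpoch q q k)).
      transitivity (cpow (-1) (k - n) * (cpow (-1) n * cpow (-1) n)
                    * / (qpoch q q (2 * n - k) * qpoch q q k)); [|ring].
      rewrite cpow_m1_sqr. ring.
Qed.

Lemma qpoch_sqr (q : C) (n : nat) :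
  qpoch (cpow q 2) (cpow q 2) n = qpoch q q n * qpoch (- q) q n.
Proof.
  induction n as [|n IH]; [cbn; ring|].
  rewrite !qpoch_S, IH.
  replace (cpow (cpow q 2) n) with (cpow q n * cpow q n).
  - change (cpow q 2) with (q * (q * 1)). ring.
  - change (cpow q 2) with (q * (q * 1)). now rewrite Cmult_1_r, cpow_mul.
Qed.

(** * Convergence *)

Definition clim (u : nat -> C) (l : C) : Prop :=
  forall eps : R, (0 < eps)%R ->
    exists N, forall n, (N <= n)%nat -> (Cmod (u n - l) < eps)%R.

Lemma clim_filterlim (u : nat -> C) (l : C) :
  clim u l <-> filterlim u eventually (locally (T := C_NormedModule) l).
Proof.
  split.
  - intros H. apply (filterlim_locally_ball_norm (U := C_NormedModule)). intros eps.
    destruct (H eps (cond_pos eps)) as [N HN]. exists N. intros n Hn.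
    unfold ball_norm. exact (HN n Hn).
  - intros H eps Heps.
    destruct (proj1 (filterlim_locally_ball_norm (U := C_NormedModule) _ _) H
                (mkposreal eps Heps)) as [N HN].
    exists N. intros n Hn. exact (HN n Hn).
Qed.

Lemma clim_climit (u : nat -> C) (l : C) : clim u l -> climit u = l.
Proof.
  intros H. unfold climit.
  apply (iota_filterlim_locally (V := C_CompleteNormedModule)).
  now apply clim_filterlim.
Qed.

Lemma clim_unique (u : nat -> C) (l m : C) : clim u l -> clim u m -> l = m.
Proof. intros Hl Hm. now rewrite <- (clim_climit u l Hl), (clim_climit u m Hm). Qed.

Lemma clim_ext (u v : nat -> C) (l : C) : (forall n, u n = v n) -> clim u l -> clim v l.
Proof.
  intros E H eps Heps. destruct (H eps Heps) as [N HN]. exists N. intros n Hn.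
  rewrite <- E. auto.
Qed.

Lemma clim_const (l : C) : clim (fun _ => l) l.
Proof.
  intros eps Heps. exists O. intros n _.
  replace (l - l) with (0 : C) by ring. now rewrite Cmod_0.
Qed.

Lemma clim_add (u : nat -> C) (l : C) (k : nat) : clim u l -> clim (fun n => u (n + k)%nat) l.
Proof.
  intros H eps Heps. destruct (H eps Heps) as [N HN]. exists N. intros n Hn.
  apply HN. lia.
Qed.

(** Truncated subtraction gives the value [u 0] for [n < k], which leaves the limit unchanged. *)
Lemma clim_sub (u : nat -> C) (l : C) (k : nat) : clim u l -> clim (fun n => u (n - k)%nat) l.
Proof.
  intros H eps Heps. destruct (H eps Heps) as [N HN]. exists (N + k)%nat. intros n Hn.
  apply HN. lia.
Qed.

Lemma clim_plus (u v : nat -> C) (l m : C) :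
  clim u l -> clim v m -> clim (fun n => u n + v n) (l + m).
Proof.
  intros Hu Hv eps Heps.
  destruct (Hu (eps / 2)%R ltac:(lra)) as [N HN].
  destruct (Hv (eps / 2)%R ltac:(lra)) as [M HM].
  exists (N + M)%nat. intros n Hn.
  replace (u n + v n - (l + m)) with ((u n - l) + (v n - m)) by ring.
  eapply Rle_lt_trans; [apply Cmod_triangle|].
  specialize (HN n ltac:(lia)). specialize (HM n ltac:(lia)). lra.
Qed.

Lemma clim_mult (u v : nat -> C) (l m : C) :
  clim u l -> clim v m -> clim (fun n => u n * v n) (l * m).
Proof.
  intros Hu Hv eps Heps.
  pose proof (Cmod_ge_0 l). pose proof (Cmod_ge_0 m).
  (* The error splits into two linear terms and one quadratic term. With [d <= 1] the quadratic term
     is at most [d], so the total is at most d (|l| + |m| + 1) <= eps/2. *)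
  set (d := Rmin 1 (eps / (2 * (Cmod l + Cmod m + 1)))%R).
  assert (Hd : (0 < d)%R).
  { apply Rmin_pos; [lra|]. apply Rdiv_lt_0_compat; lra. }
  assert (Hd1 : (d <= 1)%R) by apply Rmin_l.
  assert (Hd2 : (d * (Cmod l + Cmod m + 1) <= eps / 2)%R).
  { eapply Rle_trans; [apply Rmult_le_compat_r; [lra | apply Rmin_r]|].
    right. field. lra. }
  destruct (Hu d Hd) as [N HN]. destruct (Hv d Hd) as [M HM].
  exists (N + M)%nat. intros n Hn.
  specialize (HN n ltac:(lia)). specialize (HM n ltac:(lia)).
  replace (u n * v n - l * m)
    with ((u n - l) * m + l * (v n - m) + (u n - l) * (v n - m)) by ring.
  eapply Rle_lt_trans; [apply Cmod_triangle|].
  eapply Rle_lt_trans; [apply Rplus_le_compat_r, Cmod_triangle|].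
  rewrite !Cmod_mult.
  pose proof (Cmod_ge_0 (u n - l)). pose proof (Cmod_ge_0 (v n - m)).
  assert (Cmod (u n - l) * Cmod m <= d * Cmod m)%R by (apply Rmult_le_compat_r; lra).
  assert (Cmod l * Cmod (v n - m) <= Cmod l * d)%R by (apply Rmult_le_compat_l; lra).
  assert (Cmod (u n - l) * Cmod (v n - m) <= d * 1)%R by (apply Rmult_le_compat; lra).
  lra.
Qed.

Lemma clim_lower_bound (u : nat -> C) (l : C) (m : R) :
  clim u l -> (forall n, (m <= Cmod (u n))%R) -> (m <= Cmod l)%R.
Proof.
  intros Hu Hm. apply Rnot_lt_le. intros H.
  destruct (Hu (m - Cmod l)%R ltac:(lra)) as [N HN]. specialize (HN N (le_n N)).
  specialize (Hm N).
  pose proof (Cmod_triangle (u N - l) l) as T.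
  replace (u N - l + l) with (u N) in T by ring. lra.
Qed.

Lemma clim_inv (u : nat -> C) (l : C) (m : R) :
  (0 < m)%R -> clim u l -> (forall n, (m <= Cmod (u n))%R) -> clim (fun n => / u n) (/ l).
Proof.
  intros Hm Hu Hlow eps Heps.
  pose proof (clim_lower_bound u l m Hu Hlow) as Hl.
  assert (Hl0 : l <> 0) by (apply Cmod_gt_0; lra).
  assert (Hu0 : forall n, u n <> 0) by (intros n; apply Cmod_gt_0; specialize (Hlow n); lra).
  assert (Hmm : (0 < m * m)%R) by (apply Rmult_lt_0_compat; lra).
  destruct (Hu (eps * (m * m))%R ltac:(apply Rmult_lt_0_compat; lra)) as [N HN].
  exists N. intros n Hn. specialize (HN n Hn). specialize (Hlow n).
  replace (/ u n - / l) with (- (u n - l) * / (u n * l)) by (field; auto).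
  rewrite Cmod_mult, Cmod_opp, Cmod_inv, Cmod_mult by now apply Cmult_neq_0.
  apply (Rmult_lt_reg_r (Cmod (u n) * Cmod l)); [apply Rmult_lt_0_compat; lra|].
  rewrite Rmult_assoc, Rinv_l, Rmult_1_r.
  - eapply Rlt_le_trans; [exact HN|]. apply Rmult_le_compat_l; [lra|].
    apply Rmult_le_compat; lra.
  - apply Rmult_integral_contrapositive; lra.
Qed.

(** * Geometric domination and Tannery's theorem *)

Lemma csum_tail_bound (f : nat -> C) (E t : R) (K N : nat) :
  (0 <= E)%R -> (0 <= t < 1)%R -> (K <= N)%nat ->
  (forall k, (k <= N)%nat -> (Cmod (f k) <= E * t ^ k)%R) ->
  (Cmod (csum f N - csum f K) <= E / (1 - t) * t ^ K)%R.
Proof.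
  intros HE Ht HKN Hf.
  (* The exact geometric sum between K and N is kept, so that the induction on N closes; the term in
     [N] is dropped afterwards. *)
  assert (Hstrong : (Cmod (csum f N - csum f K) <= E / (1 - t) * (t ^ S K - t ^ S N))%R).
  { revert Hf. induction HKN as [|N HKN IH]; intros Hf.
    - replace (csum f K - csum f K) with (0 : C) by ring. rewrite Cmod_0. right. ring.
    - rewrite csum_S.
      replace (csum f N + f (S N) - csum f K) with (csum f N - csum f K + f (S N)) by ring.
      eapply Rle_trans; [apply Cmod_triangle|].
      specialize (IH (fun k Hk => Hf k (le_S _ _ Hk))). pose proof (Hf (S N) (le_n _)) as H.
      replace (E / (1 - t) * (t ^ S K - t ^ S (S N)))%R
        with (E / (1 - t) * (t ^ S K - t ^ S N) + E * t ^ S N)%R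
        by (simpl; field; lra).
      lra. }
  eapply Rle_trans; [exact Hstrong|]. apply Rmult_le_compat_l.
  - apply Rmult_le_pos; [lra|]. left. apply Rinv_0_lt_compat. lra.
  - pose proof (pow_le t K (proj1 Ht)). pose proof (pow_le t (S N) (proj1 Ht)).
    simpl in *. nra.
Qed.

Lemma pow_scaled_small (E t eps : R) :
  (0 <= E)%R -> (0 <= t < 1)%R -> (0 < eps)%R ->
  exists K, (E / (1 - t) * t ^ K < eps)%R.
Proof.
  intros HE Ht Heps.
  assert (HF : (0 <= E / (1 - t))%R).
  { apply Rmult_le_pos; [lra|]. left. apply Rinv_0_lt_compat. lra. }
  set (F := (E / (1 - t))%R) in *.
  (* The divisor is F + 1 because F may be zero. *)
  destruct (pow_lt_1_zero t ltac:(rewrite Rabs_pos_eq; lra) (eps / (F + 1))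
              ltac:(apply Rdiv_lt_0_compat; lra)) as [K HK].
  exists K. specialize (HK K (le_n K)).
  rewrite Rabs_pos_eq in HK by (apply pow_le; lra).
  assert (0 <= t ^ K)%R by (apply pow_le; lra).
  apply Rle_lt_trans with ((F + 1) * t ^ K)%R; [nra|].
  apply Rlt_le_trans with ((F + 1) * (eps / (F + 1)))%R.
  - apply Rmult_lt_compat_l; lra.
  - right. field. lra.
Qed.

Definition bounded {A : Type} (f : A -> C) : Prop :=
  exists K : R, forall x, (Cmod (f x) <= K)%R.

Lemma bounded_mult {A : Type} (f g : A -> C) :
  bounded f -> bounded g -> bounded (fun x => f x * g x).
Proof.
  intros [K HK] [L HL]. exists (K * L)%R. intros x. rewrite Cmod_mult.
  apply Rmult_le_compat; auto using Cmod_ge_0.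
Qed.

Lemma bounded_comp {A B : Type} (f : A -> C) (g : B -> A) :
  bounded f -> bounded (fun x => f (g x)).
Proof. intros [K HK]. exists K. intros x. apply HK. Qed.

Definition geom_bounded (u : nat -> C) (t : R) : Prop :=
  exists K : R, (0 <= K)%R /\ forall n, (Cmod (u n) <= K * t ^ n)%R.

Lemma Cmod_cpow (z : C) (n : nat) : Cmod (cpow z n) = (Cmod z ^ n)%R.
Proof.
  induction n as [|n IH]; [exact Cmod_1|].
  rewrite cpow_S, Cmod_mult, IH. reflexivity.
Qed.

Lemma geom_bounded_intro (f u : nat -> C) (z : C) :
  bounded f -> (forall n, u n = f n * cpow z n) -> geom_bounded u (Cmod z).
Proof.
  intros [K HK] E. exists K. split.
  - eapply Rle_trans; [apply Cmod_ge_0 | apply (HK O)].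
  - intros n. rewrite E, Cmod_mult, Cmod_cpow.
    apply Rmult_le_compat_r; [apply pow_le, Cmod_ge_0 | apply HK].
Qed.

Lemma geom_bounded_summable (u : nat -> C) (t : R) :
  (0 <= t < 1)%R -> geom_bounded u t -> exists S, clim (csum u) S.
Proof.
  intros Ht [K [HK Hu]].
  destruct (ex_series_le (V := C_CompleteNormedModule) u (fun n => K * t ^ n)%R) as [S HS].
  - exact Hu.
  - apply (ex_series_scal_l (K := R_AbsRing) K (fun n => t ^ n)%R).
    apply ex_series_geom. rewrite Rabs_pos_eq; lra.
  - exists S. now apply clim_filterlim.
Qed.

Lemma clim_csum_zero (f : nat -> nat -> C) (K : nat) :
  (forall k, clim (fun N => f N k) 0) -> clim (fun N => csum (f N) K) 0.
Proof.
  intros H. induction K as [|K IH].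
  - apply (clim_ext (fun N => f N O)); [intros; now rewrite csum_0 | apply H].
  - apply (clim_ext (fun N => csum (f N) K + f N (S K))).
    + intros N. now rewrite csum_S.
    + replace (0 : C) with (0 + 0) by ring. now apply clim_plus.
Qed.

(** Each weight is split as its limit [l] plus an error. The errors up to a fixed index J tend to 0
    with N, and those beyond J have a geometric tail bounded uniformly in N. *)
Lemma tannery (u : nat -> C) (t : R) (w : nat -> nat -> C) (l S : C) :
  (0 <= t < 1)%R -> geom_bounded u t ->
  bounded (fun p => w (fst p) (snd p)) ->
  (forall k, clim (fun N => w N k) l) ->
  clim (csum u) S ->
  clim (fun N => csum (fun k => u k * w N k) N) (S * l).
Proof.
  intros Ht [K [HK Hu]] [W HW] Hw HS.
  set (d := fun N k => u k * (w N k - l)).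
  apply (clim_ext (fun N => csum u N * l + csum (d N) N)).
  { intros N. rewrite Cmult_comm, <- csum_scal, <- csum_plus.
    apply csum_ext. intros k _. unfold d. ring. }
  replace (S * l) with (S * l + 0) by ring.
  apply clim_plus; [apply clim_mult; [exact HS | apply clim_const]|].
  assert (Hd : forall k, clim (fun N => d N k) 0).
  { intros k. replace (0 : C) with (u k * (l + - l)) by ring.
    apply clim_mult; [apply clim_const|].
    apply clim_plus; [apply Hw | apply clim_const]. }
  assert (HD : (0 <= W + Cmod l)%R).
  { pose proof (Cmod_ge_0 l). pose proof (HW (O, O)). pose proof (Cmod_ge_0 (w O O)).
    simpl in *. lra. }
  assert (HE : (0 <= K * (W + Cmod l))%R) by now apply Rmult_le_pos.
  assert (Hbound : forall N k, (Cmod (d N k) <= K * (W + Cmod l) * t ^ k)%R).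
  { intros N k. unfold d. rewrite Cmod_mult.
    replace (K * (W + Cmod l) * t ^ k)%R with (K * t ^ k * (W + Cmod l))%R by ring.
    apply Rmult_le_compat; auto using Cmod_ge_0.
    eapply Rle_trans; [apply Cmod_triangle|]. rewrite Cmod_opp.
    apply Rplus_le_compat_r. exact (HW (N, k)). }
  intros eps Heps.
  destruct (pow_scaled_small _ t (eps / 2) HE Ht ltac:(lra)) as [J HJ].
  destruct (clim_csum_zero d J Hd (eps / 2)%R ltac:(lra)) as [N0 HN0].
  exists (N0 + J)%nat. intros N HN. specialize (HN0 N ltac:(lia)).
  pose proof (csum_tail_bound (d N) _ t J N HE Ht ltac:(lia) (fun k _ => Hbound N k)) as HT.
  replace (csum (d N) N - 0) with (csum (d N) N - csum (d N) J + (csum (d N) J - 0)) by ring.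
  eapply Rle_lt_trans; [apply Cmod_triangle|]. lra.
Qed.

(** * Bounds and limits of q-shifted factorials *)

Lemma qpoch_factor_neq0 (x q : C) :
  (Cmod q < 1)%R -> (Cmod x < 1)%R -> forall k, 1 - x * cpow q k <> 0.
Proof.
  intros Hq Hx k H.
  assert (E : x * cpow q k = 1).
  { transitivity (1 - (1 - x * cpow q k)); [ring | rewrite H; ring]. }
  apply (f_equal Cmod) in E. rewrite Cmod_mult, Cmod_cpow, Cmod_1 in E.
  pose proof (Cmod_ge_0 x).
  assert (Cmod q ^ k <= 1)%R.
  { rewrite <- (pow1 k). apply pow_incr. split; [apply Cmod_ge_0 | lra]. }
  assert (0 <= Cmod q ^ k)%R by apply pow_le, Cmod_ge_0.
  nra.
Qed.

Lemma exp_monotone (x y : R) : (x <= y)%R -> (exp x <= exp y)%R.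
Proof.
  intros [H| ->]; [left; now apply exp_increasing | right; reflexivity].
Qed.

Lemma qpoch_bounded (x q : C) : (Cmod q < 1)%R -> bounded (qpoch x q).
Proof.
  intros Hq. pose proof (Cmod_ge_0 q) as Hq0. pose proof (Cmod_ge_0 x) as Hx0.
  (* Each factor satisfies |1 - x q^k| <= 1 + |x| |q|^k <= exp(|x| |q|^k), and the exponents add up
     to a geometric sum. *)
  assert (H : forall n, (Cmod (qpoch x q n)
                         <= exp (Cmod x * ((1 - Cmod q ^ n) / (1 - Cmod q))))%R).
  { induction n as [|n IH].
    - cbn [qpoch]. rewrite Cmod_1, pow_O.
      replace (Cmod x * ((1 - 1) / (1 - Cmod q)))%R with 0%R by (field; lra).
      rewrite exp_0. lra.
    - rewrite qpoch_S, Cmod_mult.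
      replace (Cmod x * ((1 - Cmod q ^ S n) / (1 - Cmod q)))%R
        with (Cmod x * ((1 - Cmod q ^ n) / (1 - Cmod q)) + Cmod x * Cmod q ^ n)%R
        by (simpl; field; lra).
      rewrite exp_plus. apply Rmult_le_compat; auto using Cmod_ge_0.
      eapply Rle_trans; [apply Cmod_triangle|].
      rewrite Cmod_opp, Cmod_1, Cmod_mult, Cmod_cpow.
      apply exp_ineq1_le. }
  exists (exp (Cmod x * (1 / (1 - Cmod q))))%R. intros n.
  eapply Rle_trans; [apply H|]. apply exp_monotone.
  apply Rmult_le_compat_l; [lra|]. apply Rmult_le_compat_r.
  - left. apply Rinv_0_lt_compat. lra.
  - pose proof (pow_le (Cmod q) n Hq0). lra.
Qed.

Lemma qpoch_lower_bound (x q : C) :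
  (Cmod q < 1)%R -> (Cmod x < 1)%R ->
  exists m : R, (0 < m)%R /\ forall n, (m <= Cmod (qpoch x q n))%R.
Proof.
  intros Hq Hx. pose proof (Cmod_ge_0 q) as Hq0. pose proof (Cmod_ge_0 x) as Hx0.
  (* This constant gives 1 / (1 - |x| p) <= 1 + y p <= exp(y p) for 0 <= p <= 1, hence |1 - x q^k|
     >= exp(-y |q|^k). *)
  set (y := (Cmod x / (1 - Cmod x))%R).
  assert (Hy : (0 <= y)%R).
  { apply Rmult_le_pos; [lra|]. left. apply Rinv_0_lt_compat. lra. }
  assert (H : forall n, (exp (- (y * ((1 - Cmod q ^ n) / (1 - Cmod q))))
                         <= Cmod (qpoch x q n))%R).
  { induction n as [|n IH].
    - cbn [qpoch]. rewrite Cmod_1, pow_O.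
      replace (- (y * ((1 - 1) / (1 - Cmod q))))%R with 0%R by (field; lra).
      rewrite exp_0. lra.
    - rewrite qpoch_S, Cmod_mult.
      replace (- (y * ((1 - Cmod q ^ S n) / (1 - Cmod q))))%R
        with (- (y * ((1 - Cmod q ^ n) / (1 - Cmod q))) + - (y * Cmod q ^ n))%R
        by (simpl; field; lra).
      rewrite exp_plus.
      apply Rmult_le_compat; try (left; apply exp_pos); auto.
      assert (Hp : (0 <= Cmod q ^ n <= 1)%R).
      { split; [apply pow_le; lra|]. rewrite <- (pow1 n). apply pow_incr. lra. }
      set (p := (Cmod q ^ n)%R) in *.
      apply Rle_trans with (1 - Cmod x * p)%R.
      + rewrite exp_Ropp.
        assert (Hpos : (0 < 1 - Cmod x * p)%R) by nra.
        rewrite <- (Rinv_inv (1 - Cmod x * p)).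
        apply Rinv_le_contravar; [now apply Rinv_0_lt_compat|].
        apply Rle_trans with (1 + y * p)%R; [|apply exp_ineq1_le].
        apply (Rmult_le_reg_r (1 - Cmod x * p)); [exact Hpos|].
        rewrite Rinv_l by lra.
        replace ((1 + y * p) * (1 - Cmod x * p))%R
          with (1 + p * (Cmod x * Cmod x / (1 - Cmod x)) * (1 - p))%R
          by (unfold y; field; lra).
        assert (0 <= p * (Cmod x * Cmod x / (1 - Cmod x)) * (1 - p))%R; [|lra].
        apply Rmult_le_pos; [|lra]. apply Rmult_le_pos; [lra|].
        apply Rmult_le_pos; [nra|]. left. apply Rinv_0_lt_compat. lra.
      + pose proof (Cmod_triangle (1 - x * cpow q n) (x * cpow q n)) as T.
        replace (1 - x * cpow q n + x * cpow q n) with (1 : C) in T by ring.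
        rewrite Cmod_1, (Cmod_mult x), Cmod_cpow in T. fold p in T. lra. }
  exists (exp (- (y * (1 / (1 - Cmod q)))))%R. split; [apply exp_pos|]. intros n.
  eapply Rle_trans; [|apply H]. apply exp_monotone. apply Ropp_le_contravar.
  apply Rmult_le_compat_l; [lra|]. apply Rmult_le_compat_r.
  - left. apply Rinv_0_lt_compat. lra.
  - pose proof (pow_le (Cmod q) n Hq0). lra.
Qed.

Lemma qpoch_inv_bounded (x q : C) :
  (Cmod q < 1)%R -> (Cmod x < 1)%R -> bounded (fun n => / qpoch x q n).
Proof.
  intros Hq Hx. destruct (qpoch_lower_bound x q Hq Hx) as [m [Hm H]].
  exists (/ m)%R. intros n.
  specialize (H n). rewrite Cmod_inv by (apply Cmod_gt_0; lra).
  now apply Rinv_le_contravar.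
Qed.

(** The differences (x)_(n+1) - (x)_n = -x (x)_n q^n are geometrically bounded, so the products
    converge as partial sums of a telescoping series. *)
Lemma qpoch_clim (x q : C) : (Cmod q < 1)%R -> clim (qpoch x q) (qpoch_inf x q).
Proof.
  intros Hq.
  assert (HL : exists L, clim (qpoch x q) L).
  { destruct (geom_bounded_summable (fun n => - (x * qpoch x q n) * cpow q n) (Cmod q))
      as [L HL].
    - split; [apply Cmod_ge_0 | exact Hq].
    - apply geom_bounded_intro with (fun n => - (x * qpoch x q n)); [|reflexivity].
      destruct (qpoch_bounded x q Hq) as [K HK]. exists (Cmod x * K)%R. intros n.
      rewrite Cmod_opp, Cmod_mult. apply Rmult_le_compat_l; auto using Cmod_ge_0.
    - exists (L + 1).
      assert (E : forall n, qpoch x q (S n)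
                  = csum (fun n => - (x * qpoch x q n) * cpow q n) n + 1).
      { induction n as [|n IH].
        - rewrite csum_0. cbn. ring.
        - rewrite csum_S, qpoch_S, IH at 1. rewrite IH. ring. }
      assert (H : clim (fun n => qpoch x q (S n)) (L + 1)).
      { apply (clim_ext (fun n => csum (fun n => - (x * qpoch x q n) * cpow q n) n + 1)).
        - intros n. now rewrite E.
        - apply clim_plus; [exact HL | apply clim_const]. }
      intros eps Heps. destruct (H eps Heps) as [N HN]. exists (S N).
      intros [|n] Hn; [lia|]. apply HN. lia. }
  destruct HL as [L HL]. unfold qpoch_inf. now rewrite (clim_climit _ _ HL).
Qed.

Lemma qpoch_inf_neq0 (x q : C) :
  (Cmod q < 1)%R -> (Cmod x < 1)%R -> qpoch_inf x q <> 0.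
Proof.
  intros Hq Hx. destruct (qpoch_lower_bound x q Hq Hx) as [m [Hm H]].
  apply Cmod_gt_0. eapply Rlt_le_trans; [exact Hm|].
  apply (clim_lower_bound (qpoch x q)); auto using qpoch_clim.
Qed.

Lemma qpoch_inv_clim (x q : C) :
  (Cmod q < 1)%R -> (Cmod x < 1)%R ->
  clim (fun n => / qpoch x q n) (/ qpoch_inf x q).
Proof.
  intros Hq Hx. destruct (qpoch_lower_bound x q Hq Hx) as [m [Hm H]].
  apply clim_inv with m; auto using qpoch_clim.
Qed.

Lemma indefinite_theta_bounded (q : C) :
  (Cmod q < 1)%R -> bounded (indefinite_theta q).
Proof.
  intros Hq. pose proof (Cmod_ge_0 q) as Hq0.
  assert (H2 : (2 <= 2 / (1 - Cmod q))%R).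
  { apply (Rmult_le_reg_r (1 - Cmod q)); [lra|].
    replace (2 / (1 - Cmod q) * (1 - Cmod q))%R with 2%R by (field; lra). lra. }
  (* This is the fixed point of t -> |q| t + 2, which dominates the recurrence
     [indefinite_theta_S]. *)
  exists (2 / (1 - Cmod q))%R. intros r. induction r as [|r IH].
  - unfold indefinite_theta. rewrite symsum_0. cbn [Nat.mul Nat.sub].
    rewrite Cmod_mult, !Cmod_cpow, !pow_O. lra.
  - rewrite indefinite_theta_S.
    eapply Rle_trans; [apply Cmod_triangle|].
    rewrite !Cmod_mult, !Cmod_cpow.
    rewrite !Cmod_R, (Rabs_left (-1)), Rabs_pos_eq by lra.
    replace (- -1)%R with 1%R by lra. rewrite pow1.
    assert (Cmod q ^ (2 * r + 1) <= Cmod q)%R.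
    { rewrite Nat.add_comm. simpl pow.
      assert (Cmod q ^ (2 * r) <= 1)%R.
      { rewrite <- (pow1 (2 * r)). apply pow_incr. lra. }
      simpl in *. nra. }
    assert (0 <= Cmod q ^ (2 * r + 1))%R by now apply pow_le.
    apply Rle_trans with (Cmod q * (2 / (1 - Cmod q)) + 2 * 1)%R.
    + apply Rplus_le_compat_r. apply Rmult_le_compat; auto using Cmod_ge_0.
    + right. field. lra.
Qed.

(** * The two evaluations of the auxiliary series *)

Lemma cpow_bounded (q : C) : (Cmod q < 1)%R -> bounded (cpow q).
Proof.
  intros Hq. exists 1%R. intros n. rewrite Cmod_cpow, <- (pow1 n).
  apply pow_incr. split; [apply Cmod_ge_0 | lra].
Qed.

Lemma one_plus_inv_bounded (q a : C) :
  (Cmod q < 1)%R -> (Cmod a < 1)%R -> bounded (fun n => / (1 + a * cpow q n)).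
Proof.
  intros Hq Ha. exists (/ (1 - Cmod a))%R. intros n.
  pose proof (Cmod_triangle (1 + a * cpow q n) (- (a * cpow q n))) as T.
  replace (1 + a * cpow q n + - (a * cpow q n)) with (1 : C) in T by ring.
  rewrite Cmod_1, Cmod_opp, Cmod_mult, Cmod_cpow in T.
  assert (Cmod q ^ n <= 1)%R.
  { rewrite <- (pow1 n). apply pow_incr. split; [apply Cmod_ge_0 | lra]. }
  assert (Cmod a * Cmod q ^ n <= Cmod a)%R.
  { pose proof (Cmod_ge_0 a). nra. }
  rewrite Cmod_inv by (apply Cmod_gt_0; lra).
  apply Rinv_le_contravar; lra.
Qed.

Lemma Cmod_mult_lt_1 (x y : C) :
  (Cmod x < 1)%R -> (Cmod y < 1)%R -> (Cmod (x * y) < 1)%R.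
Proof.
  intros Hx Hy. rewrite Cmod_mult.
  pose proof (Cmod_ge_0 x). pose proof (Cmod_ge_0 y). nra.
Qed.

(** The summand of the auxiliary series X, with (q^2; q^2)_n written as (q)_n (-q)_n. *)
Definition phi_term (q a c : C) (n : nat) : C :=
  qpoch (q / c) q n * qpoch (q / a) q n * cpow (- (a * c)) n
  / (qpoch q q n * qpoch (- q) q n).

Definition lhs_term (q a c : C) (n : nat) : C :=
  qpoch (q / c) q n * cpow c n
  / (qpoch (cpow q 2) (cpow q 2) n * (1 + a * cpow q n))
  * cpow q (n * (n + 1) / 2).

Definition hecke_term (q a c : C) (n : nat) : C :=
  (1 - cpow q (2 * n + 1)) * indefinite_theta q n
  * (qpoch (q / a) q n * qpoch (q / c) q n * cpow (a * c) n)
  / (qpoch (q * a) q n * qpoch (q * c) q n).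

Lemma hecke_term_sum (q a c : C) (n : nat) :
  sum_n
    (fun k : nat =>
       let j := Z.abs_nat (Z.of_nat k - Z.of_nat n) in
       cpow (-1) j * (1 - cpow q (2 * n + 1)) * cpow q (n * n - j * j)
       * (qpoch (q / a) q n * qpoch (q / c) q n * cpow (a * c) n)
       / (qpoch (q * a) q n * qpoch (q * c) q n))
    (2 * n)
  = hecke_term q a c n.
Proof.
  unfold hecke_term, indefinite_theta.
  match goal with |- @eq _ ?x ?y => change (@eq C x y) end.
  transitivity ((1 - cpow q (2 * n + 1))
    * (qpoch (q / a) q n * qpoch (q / c) q n * cpow (a * c) n)
    / (qpoch (q * a) q n * qpoch (q * c) q n)
    * symsum (fun j => cpow (-1) j * cpow q (n * n - j * j)) n).
  - unfold symsum. rewrite <- csum_scal. apply csum_ext. intros k _. cbv zeta.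
    unfold Cdiv. ring.
  - unfold Cdiv. ring.
Qed.

(** This is [finite_jackson] with A = q/c, b = 1/a, D = -a, z = -ac, hence bq = q/a, bDq = -q and Az
    = -aq. *)
Lemma finite_phi_lhs (q a c : C) (N : nat) :
  (Cmod q < 1)%R -> (Cmod a < 1)%R -> a <> 0 -> c <> 0 ->
  csum (fun n => phi_term q a c n
                 * (qpoch (- (a * c)) q (N - n) * / qpoch q q (N - n))) N
  = csum (fun k => lhs_term q a c k * (qpoch (- a) q (S N) * / qpoch q q (N - k))) N.
Proof.
  intros Hq Ha Ha0 Hc0.
  pose proof (qpoch_factor_neq0 q q Hq Hq) as Hqn.
  assert (Hmq : forall n, 1 - - q * cpow q n <> 0).
  { apply qpoch_factor_neq0; [|rewrite Cmod_opp]; exact Hq. }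
  assert (Hma : forall n, 1 - - a * cpow q n <> 0).
  { apply qpoch_factor_neq0; [|rewrite Cmod_opp]; assumption. }
  assert (Eb : / a * - a * q = - q) by (field; exact Ha0).
  pose proof (finite_jackson q (q / c) (/ a) (- a) (- (a * c)) N Hqn) as H.
  rewrite Eb in H. specialize (H Hmq).
  replace (/ a * q) with (q / a) in H by (field; exact Ha0).
  etransitivity; [etransitivity; [|exact H]|];
    apply csum_ext; intros k Hk; clear H.
  - reflexivity.
  - unfold lhs_term. rewrite qpoch_sqr.
    (* Here (-a)_(N+1) = (-a)_k (1 + a q^k) (-a q^(k+1))_(N-k). Jackson's formula supplies the outer
       two factors, so the middle one appears as the denominator 1 + a q^k of [lhs_term]. *)
    replace (S N) with (S k + (N - k))%nat by lia.
    rewrite (qpoch_add (- a)), qpoch_S, cpow_S.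
    replace (q / c * - (a * c) * cpow q k) with (- a * (q * cpow q k))
      by (field; exact Hc0).
    replace (cpow c k) with (cpow (- (a * c)) k * cpow (-1) k * cpow (/ a) k).
    2: { rewrite <- !cpow_mul. f_equal. field. exact Ha0. }
    pose proof (qpoch_neq0 q q k Hqn). pose proof (qpoch_neq0 q q (N - k) Hqn).
    pose proof (qpoch_neq0 (- q) q k Hmq).
    assert (1 + a * cpow q k <> 0).
    { replace (1 + a * cpow q k) with (1 - - a * cpow q k) by ring. apply Hma. }
    field. repeat split; auto.
Qed.

(** This is [finite_bailey] with A = q/a, B = q/c, z = ac, so that ABz = q^2 and the pair is
    relative to [q]. *)
Lemma finite_phi_hecke (q a c : C) (N : nat) :
  (Cmod q < 1)%R -> (Cmod a < 1)%R -> (Cmod c < 1)%R -> a <> 0 -> c <> 0 ->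
  csum (fun n => phi_term q a c n
                 * (qpoch (a * c) q (N - n) * / qpoch q q (N - n))) N
  = csum (fun r => hecke_term q a c r
                   * (qpoch (q * a) q N * qpoch (q * c) q N
                      * (/ qpoch q q (N - r) * / qpoch q q (S (N + r))))) N.
Proof.
  intros Hq Ha Hc Ha0 Hc0.
  pose proof (qpoch_factor_neq0 q q Hq Hq) as Hqn.
  assert (Hmq : forall n, 1 - - q * cpow q n <> 0).
  { apply qpoch_factor_neq0; [|rewrite Cmod_opp]; exact Hq. }
  pose proof (qpoch_factor_neq0 (q * a) q Hq (Cmod_mult_lt_1 _ _ Hq Ha)) as Hqa.
  pose proof (qpoch_factor_neq0 (q * c) q Hq (Cmod_mult_lt_1 _ _ Hq Hc)) as Hqc.
  assert (Hqq : forall n, 1 - q * q * cpow q n <> 0).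
  { apply qpoch_factor_neq0; auto using Cmod_mult_lt_1. }
  assert (H1q : 1 - q <> 0).
  { pose proof (Hqn O) as H. change (cpow q 0) with (1 : C) in H.
    now rewrite Cmult_1_r in H. }
  assert (Eq : q / a * (q / c) * (a * c) = q * q) by (field; auto).
  pose proof (finite_bailey q (q / a) (q / c) (a * c)
    (fun r => (1 - cpow q (2 * r + 1)) * indefinite_theta q r) N Hqn) as H.
  rewrite Eq in H. specialize (H Hqq).
  replace (a * c * (q / a)) with (q * c) in H by (field; auto).
  replace (a * c * (q / c)) with (q * a) in H by (field; auto).
  assert (Eqq : forall n, / qpoch (q * q) q n = (1 - q) * / qpoch q q (S n)).
  { intros n. rewrite (qpoch_shift q). pose proof (qpoch_neq0 _ q n Hqq). field. auto. }
  (* The factor 1 - q reconciles (q^2)_n in Bailey's lemma with (q)_(n+1) in [bailey_pair]. *)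
  apply (Cmult_cancel_l (1 - q)); [exact H1q|]. rewrite <- !csum_scal.
  etransitivity; [etransitivity; [|exact H]|];
    apply csum_ext; intros k Hk; clear H.
  - rewrite (csum_ext _ (fun r => (1 - q)
      * ((1 - cpow q (2 * r + 1)) * indefinite_theta q r
         / (qpoch q q (k - r) * qpoch q q (S (k + r)))))).
    + rewrite csum_scal, bailey_pair by assumption. unfold phi_term.
      replace (- (a * c)) with (a * c * -1) by ring. rewrite cpow_mul.
      unfold Cdiv. ring.
    + intros r Hr. unfold Cdiv. rewrite !Cinv_mult, Eqq. ring.
  - unfold hecke_term, Cdiv. rewrite !Cinv_mult, Eqq.
    replace (qpoch (q * a) q N) with (qpoch (q * a) q k * qpoch (q * a * cpow q k) q (N - k)).
    2: { rewrite <- qpoch_add. f_equal. lia. }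
    replace (qpoch (q * c) q N) with (qpoch (q * c) q k * qpoch (q * c * cpow q k) q (N - k)).
    2: { rewrite <- qpoch_add. f_equal. lia. }
    pose proof (qpoch_neq0 q q (N - k) Hqn). pose proof (qpoch_neq0 q q (S (N + k)) Hqn).
    pose proof (qpoch_neq0 (q * a) q k Hqa). pose proof (qpoch_neq0 (q * c) q k Hqc).
    field. repeat split; auto.
Qed.

Lemma qpoch_ratio_weight (z q : C) :
  (Cmod q < 1)%R ->
  bounded (fun p : nat * nat =>
             qpoch z q (fst p - snd p) * / qpoch q q (fst p - snd p))
  /\ forall k, clim (fun N => qpoch z q (N - k) * / qpoch q q (N - k))
                    (qpoch_inf z q * / qpoch_inf q q).
Proof.
  intros Hq. split.
  - apply (bounded_comp (fun n => qpoch z q n * / qpoch q q n)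
             (fun p : nat * nat => (fst p - snd p)%nat)).
    apply bounded_mult; auto using qpoch_bounded, qpoch_inv_bounded.
  - intros k. apply (clim_sub (fun n => qpoch z q n * / qpoch q q n)).
    apply clim_mult; auto using qpoch_clim, qpoch_inv_clim.
Qed.

Theorem theorem6p1 (q a c : C) :
  (0 < Cmod q)%R -> (Cmod q < 1)%R ->
  (Cmod a < 1)%R -> (Cmod c < 1)%R ->
  a <> 0 -> c <> 0 ->
  exists S : C,
    is_series
      (fun n : nat =>
         sum_n
           (fun k : nat =>
              let j := Z.abs_nat (Z.of_nat k - Z.of_nat n) in
              cpow (-1) j * (1 - cpow q (2 * n + 1)) * cpow q (n * n - j * j)
              * (qpoch (q / a) q n * qpoch (q / c) q n * cpow (a * c) n)
              / (qpoch (q * a) q n * qpoch (q * c) q n))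
           (2 * n))
      S
    /\
    is_series
      (fun n : nat =>
         qpoch (q / c) q n * cpow c n
         / (qpoch (cpow q 2) (cpow q 2) n * (1 + a * cpow q n))
         * cpow q (n * (n + 1) / 2))
      (qpoch_inf (q * a) q * qpoch_inf (q * c) q * qpoch_inf (- (a * c)) q
       / (qpoch_inf q q * qpoch_inf (a * c) q * qpoch_inf (- a) q) * S).
Proof.
  intros Hq0 Hq Ha Hc Ha0 Hc0.
  assert (Hmq : (Cmod (- q) < 1)%R) by now rewrite Cmod_opp.
  assert (Hma : (Cmod (- a) < 1)%R) by now rewrite Cmod_opp.
  pose proof (Cmod_mult_lt_1 _ _ Ha Hc) as Hac.
  assert (Hmac : (0 <= Cmod (- (a * c)) < 1)%R)
    by (split; [apply Cmod_ge_0 | now rewrite Cmod_opp]).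
  assert (Hac' : (0 <= Cmod (a * c) < 1)%R) by (split; [apply Cmod_ge_0 | exact Hac]).
  assert (Hc' : (0 <= Cmod c < 1)%R) by (split; [apply Cmod_ge_0 | exact Hc]).
  assert (Gphi : geom_bounded (phi_term q a c) (Cmod (- (a * c)))).
  { apply geom_bounded_intro with (fun n => qpoch (q / c) q n * qpoch (q / a) q n
      * (/ qpoch q q n * / qpoch (- q) q n)).
    - repeat apply bounded_mult; auto using qpoch_bounded, qpoch_inv_bounded.
    - intros n. unfold phi_term, Cdiv. rewrite Cinv_mult. ring. }
  (* The decay is taken from c^n alone; q^(n(n+1)/2) is merely bounded by 1. *)
  assert (Glhs : geom_bounded (lhs_term q a c) (Cmod c)).
  { apply geom_bounded_intro with (fun n => qpoch (q / c) q n
      * (/ qpoch q q n * / qpoch (- q) q n) * / (1 + a * cpow q n)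
      * cpow q (n * (n + 1) / 2)).
    - repeat apply bounded_mult;
        auto using qpoch_bounded, qpoch_inv_bounded, one_plus_inv_bounded.
      apply (bounded_comp (cpow q)). now apply cpow_bounded.
    - intros n. unfold lhs_term, Cdiv. rewrite qpoch_sqr, !Cinv_mult. ring. }
  assert (Ghecke : geom_bounded (hecke_term q a c) (Cmod (a * c))).
  { apply geom_bounded_intro with (fun n => (1 - cpow q (2 * n + 1))
      * indefinite_theta q n * (qpoch (q / a) q n * qpoch (q / c) q n)
      * (/ qpoch (q * a) q n * / qpoch (q * c) q n)).
    - repeat apply bounded_mult;
        auto using qpoch_bounded, qpoch_inv_bounded, indefinite_theta_bounded,
          Cmod_mult_lt_1.
      destruct (cpow_bounded q Hq) as [K HK]. exists (1 + K)%R. intros n.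
      eapply Rle_trans; [apply Cmod_triangle|].
      rewrite Cmod_opp, Cmod_1. apply Rplus_le_compat_l, HK.
    - intros n. unfold hecke_term, Cdiv. rewrite Cinv_mult. ring. }
  destruct (geom_bounded_summable _ _ Hmac Gphi) as [X HX].
  destruct (geom_bounded_summable _ _ Hc' Glhs) as [L HL].
  destruct (geom_bounded_summable _ _ Hac' Ghecke) as [S HS].
  exists S. split.
  { apply clim_filterlim. apply (clim_ext (csum (hecke_term q a c))); [|exact HS].
    intros n. apply csum_ext. intros k _. symmetry. apply hecke_term_sum. }
  pose proof (qpoch_inf_neq0 q q Hq Hq) as Nq.
  pose proof (qpoch_inf_neq0 (- a) q Hq Hma) as Na.
  pose proof (qpoch_inf_neq0 (a * c) q Hq Hac) as Nac.
  (* Both sides are limits of the same finite sums, evaluated by Tannery's theorem before and after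
     [finite_phi_lhs]. *)
  assert (EL : X * (qpoch_inf (- (a * c)) q * / qpoch_inf q q)
               = L * (qpoch_inf (- a) q * / qpoch_inf q q)).
  { apply clim_unique with (fun N => csum (fun n => phi_term q a c n
      * (qpoch (- (a * c)) q (N - n) * / qpoch q q (N - n))) N).
    - destruct (qpoch_ratio_weight (- (a * c)) q Hq) as [HB Hlim].
      exact (tannery _ _ (fun N n => qpoch (- (a * c)) q (N - n) * / qpoch q q (N - n))
               _ _ Hmac Gphi HB Hlim HX).
    - eapply clim_ext; [intros N; symmetry; now apply finite_phi_lhs|].
      apply (tannery _ _ (fun N k => qpoch (- a) q (Datatypes.S N) * / qpoch q q (N - k))
               _ _ Hc' Glhs); [| |exact HL].
      + apply bounded_mult.
        * apply (bounded_comp (qpoch (- a) q) (fun p => Datatypes.S (fst p))).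
          now apply qpoch_bounded.
        * apply (bounded_comp (fun n => / qpoch q q n) (fun p => (fst p - snd p)%nat)).
          now apply qpoch_inv_bounded.
      + intros k. apply clim_mult.
        * apply (clim_ext (fun n => qpoch (- a) q (n + 1))).
          { intros n. now rewrite Nat.add_1_r. }
          apply clim_add. now apply qpoch_clim.
        * apply (clim_sub (fun n => / qpoch q q n)). now apply qpoch_inv_clim. }
  (* The same argument with [finite_phi_hecke]; for fixed r, both (q)_(N-r) and (q)_(N+r+1) tend to
     (q)_oo, whence the squared denominator. *)
  assert (ES : X * (qpoch_inf (a * c) q * / qpoch_inf q q)
               = S * (qpoch_inf (q * a) q * qpoch_inf (q * c) q
                      * (/ qpoch_inf q q * / qpoch_inf q q))).
  { apply clim_unique with (fun N => csum (fun n => phi_term q a c n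
      * (qpoch (a * c) q (N - n) * / qpoch q q (N - n))) N).
    - destruct (qpoch_ratio_weight (a * c) q Hq) as [HB Hlim].
      exact (tannery _ _ (fun N n => qpoch (a * c) q (N - n) * / qpoch q q (N - n))
               _ _ Hmac Gphi HB Hlim HX).
    - eapply clim_ext; [intros N; symmetry; now apply finite_phi_hecke|].
      apply (tannery _ _ (fun N r => qpoch (q * a) q N * qpoch (q * c) q N
               * (/ qpoch q q (N - r) * / qpoch q q (Datatypes.S (N + r))))
               _ _ Hac' Ghecke); [| |exact HS].
      + pose proof (qpoch_inv_bounded q q Hq Hq) as HB.
        repeat apply bounded_mult.
        * apply (bounded_comp (qpoch (q * a) q) fst). now apply qpoch_bounded.
        * apply (bounded_comp (qpoch (q * c) q) fst). now apply qpoch_bounded.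
        * exact (bounded_comp _ (fun p => (fst p - snd p)%nat) HB).
        * exact (bounded_comp _ (fun p => Datatypes.S (fst p + snd p)) HB).
      + intros r. pose proof (qpoch_inv_clim q q Hq Hq) as HI.
        repeat apply clim_mult; auto using qpoch_clim.
        * exact (clim_sub _ _ r HI).
        * apply (clim_ext (fun n => / qpoch q q (n + Datatypes.S r))).
          { intros n. now rewrite Nat.add_succ_r. }
          exact (clim_add _ _ (Datatypes.S r) HI). }
  (* It remains to eliminate X from [EL] and [ES], dividing by infinite products that are nonzero
     because |q|, |a| and |ac| are below 1. *)
  replace (_ * S) with L.
  { now apply clim_filterlim. }
  assert (EX : X = S * (qpoch_inf (q * a) q * qpoch_inf (q * c) q
                        / (qpoch_inf q q * qpoch_inf (a * c) q))).
  { transitivity (X * (qpoch_inf (a * c) q * / qpoch_inf q q)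
                  * (qpoch_inf q q / qpoch_inf (a * c) q)); [field; auto|].
    rewrite ES. field. auto. }
  transitivity (L * (qpoch_inf (- a) q * / qpoch_inf q q)
                * (qpoch_inf q q / qpoch_inf (- a) q)); [field; auto|].
  rewrite <- EL, EX. field. auto.
Qed.
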